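(* Let $G=(V,E)$ be a finite graph and let $\Gamma$ be a non-trivial finite family of objects on $G$ with Fulkerson blocker $\hat\Gamma$. Let $1<p<\infty$ and let $q:=p/(p-1)$ be its Hölder conjugate exponent. For any set of weights $\sigma\in\mathbb{R}_{>0}^E$ define the dual set of weights $\hat\sigma$ by $\hat\sigma(e):=\sigma(e)^{-q/p}$ for all $e\in E$. Then $$\operatorname{Mod}_{p,\sigma}(\Gamma)^{\frac1p}\,\operatorname{Mod}_{q,\hat\sigma}(\hat\Gamma)^{\frac1q}=1.$$ Moreover, the optimal densities $\rho^*\in\operatorname{Adm}(\Gamma)$ for $\operatorname{Mod}_{p,\sigma}(\Gamma)$ and $\eta^*\in\operatorname{Adm}(\hat\Gamma)$ for $\operatorname{Mod}_{q,\hat\sigma}(\hat\Gamma)$ are unique and are related by $$\eta^*(e)=\frac{\sigma(e)\,\rho^*(e)^{p-1}}{\operatorname{Mod}_{p,\sigma}(\Gamma)}\qquad\text{for all } e\in E.$$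
   Context: A finite family of objects $\Gamma$ on a finite graph $G=(V,E)$ is a finite set together with a usage matrix $\mathcal N=\mathcal N(\Gamma)\in\mathbb{R}_{\ge0}^{\Gamma\times E}$; $\mathcal N(\gamma,e)$ is the usage of edge $e$ by the object $\gamma$, and $\gamma$ is identified with its row $\mathcal N(\gamma,\cdot)\in\mathbb{R}_{\ge0}^E$. The family is non-trivial if $\Gamma\neq\varnothing$ and each $\gamma\in\Gamma$ has $\mathcal N(\gamma,e)>0$ for at least one $e\in E$. The admissible set is $\operatorname{Adm}(\Gamma):=\{\rho\in\mathbb{R}_{\ge0}^E:\ \sum_{e\in E}\mathcal N(\gamma,e)\rho(e)\ge1\ \text{for all }\gamma\in\Gamma\}$. For $1\le p<\infty$ and weights $\sigma\in\mathbb{R}_{>0}^E$, $\mathcal E_{p,\sigma}(\rho):=\sum_{e\in E}\sigma(e)\rho(e)^p$ and $\operatorname{Mod}_{p,\sigma}(\Gamma):=\inf_{\rho\in\operatorname{Adm}(\Gamma)}\mathcal E_{p,\sigma}(\rho)$. An optimal density is an admissible density attaining this infimum. The Fulkerson blocker $\hat\Gamma$ of $\Gamma$ is the (finite) set of extreme points of the polyhedron $\operatorname{Adm}(\Gamma)\subset\mathbb{R}_{\ge0}^E$. It is itself regarded as a family of objects, whose usage matrix $\hat{\mathcal N}\in\mathbb{R}_{\ge0}^{\hat\Gamma\times E}$ has the vectors $\hat\gamma^T$, $\hat\gamma\in\hat\Gamma$, as rows. *)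

(* Defs.v *)
From HB Require Import structures.
From mathcomp Require Import all_boot all_order all_algebra.
From mathcomp Require Import finmap.
From mathcomp Require Import all_classical all_reals all_analysis.
From mathcomp Require Import ring lra.

Set Implicit Arguments.
Unset Strict Implicit.
Unset Printing Implicit Defensive.

Import Order.TTheory GRing.Theory Num.Theory.
Import numFieldNormedType.Exports.

Local Open Scope classical_set_scope.
Local Open Scope ring_scope.

(* Parallel edges and loops are allowed. An undirected edge is given with an
   arbitrary orientation, which nothing below depends on. *)
Record graph := Graph {
  vertex : finType;
  edge : finType;
  endpoints : edge -> vertex * vertex
}.

(* [R^o] rather than [R], so that the lmodType structure is inferred. *)
Notation edge_space R G := {ffun edge G -> R^o}.

Section Modulus.
Variables (R : realType) (G : graph).
Local Notation E := (edge G).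

(* [usage gamma] is the row of [gamma] in the usage matrix; distinct objects
   may have equal rows. *)
Record object_family := ObjectFamily {
  object :> finType;
  usage : object -> edge_space R G;
  usage_ge0 : forall gamma e, 0 <= usage gamma e
}.

Definition nontrivial (Gamma : object_family) : Prop :=
  (0 < #|Gamma|)%N /\
  forall gamma : Gamma, exists e : E, 0 < usage gamma e.

Definition Adm (Gamma : object_family) : set (edge_space R G) :=
  [set rho | (forall e, 0 <= rho e) /\
             (forall gamma : Gamma, 1 <= \sum_e usage gamma e * rho e)].

Definition energy (p : R) (sigma rho : edge_space R G) : R :=
  \sum_e sigma e * rho e `^ p.

(* [inf] is real-valued; when the family is non-trivial, [Adm Gamma] is
   nonempty and the energies are bounded below by 0, so that this is the
   genuine infimum. *)
Definition Mod (p : R) (sigma : edge_space R G) (Gamma : object_family) : R :=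
  inf [set energy p sigma rho | rho in Adm Gamma].

Definition optimal (p : R) (sigma : edge_space R G) (Gamma : object_family)
    (rho : edge_space R G) : Prop :=
  Adm Gamma rho /\ energy p sigma rho = Mod p sigma Gamma.

Definition dual_weights (p q : R) (sigma : edge_space R G) : edge_space R G :=
  [ffun e => sigma e `^ (- (q / p))].

Definition extreme_points (A : set (edge_space R G)) : set (edge_space R G) :=
  [set x | A x /\ forall (y z : edge_space R G) (t : R), A y -> A z ->
             0 < t < 1 -> x = t *: y + (1 - t) *: z -> y = x /\ z = x].

(* An extreme point is determined by the set of constraints that are tight
   there, hence there are finitely many of them. *)
Section Finiteness.
Variable Gamma : object_family.

Let slack (i : Gamma + E) (rho : edge_space R G) : R :=
  match i with
  | inl gamma => \sum_e usage gamma e * rho e - 1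
  | inr e => rho e
  end.

Let AdmE rho : Adm Gamma rho <-> forall i, 0 <= slack i rho.
Proof.
split=> [[rho0 rho1] [g|e] /=|H]; rewrite ?subr_ge0 //.
split=> [e|g]; first exact: (H (inr e)).
by rewrite -subr_ge0; exact: (H (inl g)).
Qed.

Let slack_affine i (x y : edge_space R G) (a : R) :
  slack i (x + a *: (x - y)) = slack i x + a * (slack i x - slack i y).
Proof.
case: i => [g|e] /=; last by rewrite !ffunE.
have -> : \sum_e usage g e * (x + a *: (x - y)) e =
    \sum_e usage g e * x e +
    a * (\sum_e usage g e * x e - \sum_e usage g e * y e).
  rewrite -sumrB mulr_sumr -big_split; apply: eq_bigr => e _ /=.
  rewrite !ffunE /GRing.scale /=; ring.
ring.
Qed.

Let tight (x : edge_space R G) : {set Gamma + E} :=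
  [set i | slack i x == 0]%SET.

Let tight_inj : {in extreme_points (Adm Gamma) &, injective tight}.
Proof.
move=> x y; rewrite !inE => -[Ax extx] [Ay _] txy.
have sx := (AdmE x).1 Ax; have sy := (AdmE y).1 Ay.
pose M : R := 1 + \sum_i slack i y / slack i x.
have M0 : 0 < M.
  by rewrite ltr_wpDr //; apply: sumr_ge0 => i _; exact: divr_ge0.
have yMx i : slack i y <= M * slack i x.
  have [x0|x0] := eqVneq (slack i x) 0.
    have : i \in tight x by rewrite inE x0.
    by rewrite txy inE => /eqP ->; rewrite x0 mulr0.
  rewrite -ler_pdivrMr ?lt_def ?x0 ?sx // /M (bigD1 i) //= addrCA lerDl.
  by rewrite addr_ge0 //; apply: sumr_ge0 => j _; exact: divr_ge0.
pose z : edge_space R G := x + M^-1 *: (x - y).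
have Az : Adm Gamma z.
  apply/AdmE => i; rewrite /z slack_affine -(pmulr_rge0 _ M0).
  rewrite mulrDr mulrA divff ?gt_eqF // mul1r addrA.
  by rewrite subr_ge0 (le_trans (yMx i)) // lerDl.
have M1 : 0 < M + 1 by rewrite addr_gt0.
have t01 : 0 < M / (M + 1) < 1.
  by rewrite divr_gt0 //= ltr_pdivrMr // mul1r ltrDl.
have [] // := extx z y (M / (M + 1)) Az Ay t01.
apply/ffunP => e; rewrite !ffunE /GRing.scale /=.
by field; rewrite !gt_eqF.
Qed.

Lemma extreme_points_finite : finite_set (extreme_points (Adm Gamma)).
Proof.
by rewrite -(eq_finite_set (inj_card_eq tight_inj)); exact: finite_finset.
Qed.

End Finiteness.

(* [fset_set] is exact here, by [extreme_points_finite]. *)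
Definition blocker_object (Gamma : object_family) : finType :=
  fset_set (extreme_points (Adm Gamma)).

Fact blocker_usage_ge0 (Gamma : object_family) (x : blocker_object Gamma) e :
  0 <= (val x : edge_space R G) e.
Proof.
have := valP x; rewrite in_fset_set ?inE; last exact: extreme_points_finite.
by case=> -[].
Qed.

Definition blocker (Gamma : object_family) : object_family :=
  {| object := blocker_object Gamma;
     usage := fun x => val x;
     usage_ge0 := @blocker_usage_ge0 Gamma |}.

End Modulus.

(* Main.v *)
Require Import Defs.
From mathcomp Require Import all_boot all_order all_algebra.
From mathcomp Require Import finmap.
From mathcomp Require Import all_classical all_reals all_analysis.
From mathcomp Require Import ring lra.

(** Write E for the energy and M for the modulus of Gamma. The theorem combines
    a first-order optimality condition with a description of the admissible
    set of the blocker that does not mention extreme points.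

    First order. For p > 1 the tangent inequality
    a^p >= b^p + p b^(p-1) (a - b), strict when a <> b ([powR_gt_tangent]),
    summed over the edges, shows that an admissible rho is the unique
    optimal density as soon as
      sum_e sigma(e) rho(e)^(p-1) (rho'(e) - rho(e)) >= 0
    for every admissible rho' ([unique_optimal]). Conversely a minimizer
    satisfies this inequality ([minimizer_variational]), and a minimizer
    exists by compactness ([exists_minimizer]).

    Blocker. An eta >= 0 is admissible for the blocker if and only if its
    pairing with every admissible rho is at least 1 ([Adm_blockerP]), because
    the pairing with eta is at most as large at some extreme point of
    Adm(Gamma) as it is at rho ([extreme_point_below]).

    Duality. Let rho be the minimizer and put eta := sigma rho^(p-1) / M. The
    pairing of rho and eta is E(rho) / M = 1, so the first-order inequality
    for rho says that the pairing of eta with every density admissible for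
    Gamma is at least 1: eta is admissible for the blocker. With s' the dual
    weights, (p-1)(q-1) = 1 implies that the gradient inverts:
    s' eta^(q-1) = M^(1-q) rho. Hence the first-order inequality that makes
    eta the unique optimal density of the dual problem says that the pairing
    of rho with every density admissible for the blocker is at least 1, which
    is again the description of the blocker. The same gradient identity,
    paired with eta, shows that the dual modulus is M^(1-q), and
    1/p + (1-q)/q = 0. *)

Set Implicit Arguments.
Unset Strict Implicit.
Unset Printing Implicit Defensive.

Import Order.TTheory GRing.Theory Num.Theory.
Import numFieldNormedType.Exports.

Local Open Scope classical_set_scope.
Local Open Scope ring_scope.

(** * Real powers *)

(** Strict convexity of the p-th power without derivatives. For positive
    a = e^x and b = e^y the claim is the strict weighted arithmetic-geometric
    mean inequality p e^c < e^(px) + (p-1) e^(py) with c = x + (p-1) y, which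
    is the sum of two tangent inequalities of the exponential at c. *)
Lemma powR_gt_tangent (R : realType) (p a b : R) : 1 < p -> 0 <= a -> 0 <= b ->
  a != b -> b `^ p + p * b `^ (p - 1) * (a - b) < a `^ p.
Proof.
move=> p1 a0 b0 ab.
have p0 : 0 < p by lra.
have pB1 : p - 1 != 0 by lra.
have -> : b `^ p + p * b `^ (p - 1) * (a - b) =
    (1 - p) * b `^ p + p * (a * b `^ (p - 1)).
  by rewrite -(mulr_powRB1 b0 p0); ring.
have [b00|bN0] := eqVneq b 0.
  rewrite b00 in ab *; rewrite !powR0 ?gt_eqF// ?subr_gt0// !mulr0 addr0.
  by rewrite powR_gt0// lt_neqAle eq_sym ab.
have bp : 0 < b by rewrite lt_neqAle eq_sym bN0.
have [->|aN0] := eqVneq a 0.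
  rewrite mul0r mulr0 addr0 powR0 ?gt_eqF// nmulr_rlt0 ?powR_gt0//; lra.
have ap : 0 < a by rewrite lt_neqAle eq_sym aN0.
rewrite /powR (negbTE aN0) (negbTE bN0) -[in X in _ + X](lnK ap) -expRD.
have xy : ln a != ln b by apply: contra ab => /eqP /ln_inj ->.
set x := ln a in xy *; set y := ln b in xy *.
set c := x + (p - 1) * y.
have tangent z : p * z - c != 0 -> expR c * (1 + (p * z - c)) < expR (p * z).
  move=> zc; rewrite -[in ltRHS](subrKC c (p * z)).
  by rewrite [expR (c + _)]expRD ltr_pM2l ?expR_gt0 ?expR_gt1Dx.
have tangent_x : expR c * (1 + (p * x - c)) < expR (p * x).
  apply: tangent; have -> : p * x - c = (p - 1) * (x - y) by rewrite /c; ring.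
  by rewrite mulf_neq0// subr_eq0.
have tangent_y : expR c * (1 + (p * y - c)) < expR (p * y).
  apply: tangent; have -> : p * y - c = y - x by rewrite /c; ring.
  by rewrite subr_eq0 eq_sym.
have := ltrD tangent_x (_ : (p - 1) * (expR c * (1 + (p * y - c))) <
  (p - 1) * expR (p * y)).
rewrite ltr_pM2l; last lra.
move=> /(_ tangent_y).
have -> : expR c * (1 + (p * x - c)) + (p - 1) * (expR c * (1 + (p * y - c))) =
  p * expR c by rewrite /c; ring.
lra.
Qed.

(** The absolute value matters: [powR] takes the value 1 on negative reals, so
    that the bare power is discontinuous at 0. *)
Lemma continuous_norm_powR (R : realType) (p : R) : 0 < p ->
  continuous (fun x : R => `|x| `^ p).
Proof.
move=> p0 x; have [->|xN0] := eqVneq x 0.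
  rewrite /continuous_at normr0 powR0 ?gt_eqF//.
  apply/cvgrPdist_lt => e e0; near=> y.
  rewrite sub0r normrN ger0_norm ?powR_ge0//.
  have -> : e = (e `^ p^-1) `^ p.
    by rewrite -powRrM mulVf ?gt_eqF// powRr1// ltW.
  rewrite gt0_ltr_powR ?nnegrE ?powR_ge0 ?normr_ge0//.
  near: y; apply/nbhs_ballP; exists (e `^ p^-1); first exact: powR_gt0.
  by move=> y /=; rewrite /ball_/= sub0r normrN.
have powE (y : R) : y != 0 -> `|y| `^ p = expR (p * ln `|y|).
  by move=> yN0; rewrite /powR normr_eq0 (negbTE yN0).
have cont_ln : {for x, continuous (fun y : R => ln `|y|)}.
  apply: (@continuous_comp _ _ _ (fun y : R => `|y|) (@ln R)).
    exact: norm_continuous.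
  by apply: continuous_ln; rewrite normr_gt0.
have cont_exp : {for x, continuous (expR \o (fun y : R => p * ln `|y|))}.
  apply: continuous_comp; last exact: continuous_expR.
  exact: cvgMl_tmp cont_ln.
rewrite /continuous_at powE//.
apply: cvg_trans cont_exp.
apply: near_eq_cvg; near=> y => /=; rewrite powE//.
by near: y; apply: (cvgr_neq0 x); first exact: cvg_id.
Unshelve. all: by end_near. Qed.

(** * First-order optimality *)

Section Variational.
Variables (R : realType) (G : graph).
Implicit Types (p : R) (sigma rho : edge_space R G) (Gamma : object_family R G).

Lemma energy_gt_tangent p sigma rho rho' : 1 < p -> (forall e, 0 < sigma e) ->
  (forall e, 0 <= rho e) -> (forall e, 0 <= rho' e) -> rho' != rho ->
  energy p sigma rho +
    p * \sum_e sigma e * rho e `^ (p - 1) * (rho' e - rho e) <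
  energy p sigma rho'.
Proof.
move=> p1 s0 r0 r0' neq.
have [e0 ne0] : exists e, rho' e != rho e.
  apply/existsP; apply: contraNT neq; rewrite negb_exists => /forallP eqr.
  by apply/eqP/ffunP => e; apply/eqP; rewrite -[_ == _]negbK.
have term e : sigma e * rho e `^ p +
    p * (sigma e * rho e `^ (p - 1) * (rho' e - rho e)) =
    sigma e * (rho e `^ p + p * rho e `^ (p - 1) * (rho' e - rho e)) by ring.
rewrite /energy mulr_sumr -big_split /= (bigD1 e0)//= [ltRHS](bigD1 e0)//=.
apply: ltr_leD; first by rewrite term ltr_pM2l// powR_gt_tangent.
apply: ler_sum => e _; rewrite term ler_pM2l//.
have [->|ne] := eqVneq (rho' e) (rho e); first by rewrite subrr mulr0 addr0.
exact/ltW/powR_gt_tangent.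
Qed.

Lemma energy_lt p sigma rho rho' : 1 < p -> (forall e, 0 < sigma e) ->
  (forall e, 0 <= rho e) -> (forall e, 0 <= rho' e) ->
  0 <= \sum_e sigma e * rho e `^ (p - 1) * (rho' e - rho e) ->
  rho' != rho -> energy p sigma rho < energy p sigma rho'.
Proof.
move=> p1 s0 r0 r0' var neq.
apply: le_lt_trans (energy_gt_tangent p1 s0 r0 r0' neq).
by rewrite lerDl mulr_ge0//; lra.
Qed.

Lemma Adm_segment Gamma rho rho' (t : R) : Adm Gamma rho -> Adm Gamma rho' ->
  0 <= t <= 1 -> Adm Gamma (rho + t *: (rho' - rho)).
Proof.
move=> [r0 r1] [r0' r1'] t01.
have coord e : (rho + t *: (rho' - rho)) e = (1 - t) * rho e + t * rho' e.
  by rewrite !ffunE /GRing.scale /=; ring.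
have t1 : 0 <= 1 - t by lra.
have t0 : 0 <= t by lra.
split=> [e|gamma]; first by rewrite coord addr_ge0// mulr_ge0.
have -> : \sum_e usage gamma e * (rho + t *: (rho' - rho)) e =
    (1 - t) * \sum_e usage gamma e * rho e + t * \sum_e usage gamma e * rho' e.
  rewrite !mulr_sumr -big_split; apply: eq_bigr => e _ /=; rewrite coord; ring.
have := ler_wpM2l t1 (r1 gamma); have := ler_wpM2l t0 (r1' gamma); lra.
Qed.

(** Instead of differentiating the energy along the segment from [rho] to
    [rho'], apply the tangent inequality at the point of parameter t > 0 and
    compare with the value at [rho], which is minimal: the condition holds
    with the gradient taken at t, and t tends to 0 by continuity. *)
Lemma minimizer_variational p sigma Gamma rho : 1 < p ->
  (forall e, 0 < sigma e) -> Adm Gamma rho ->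
  (forall rho', Adm Gamma rho' -> energy p sigma rho <= energy p sigma rho') ->
  forall rho', Adm Gamma rho' ->
    0 <= \sum_e sigma e * rho e `^ (p - 1) * (rho' e - rho e).
Proof.
move=> p1 s0 Ar rmin rho' Ar'; have p0 : 0 < p by lra.
have pB1 : 0 < p - 1 by lra.
pose F (t : R) : R := \sum_e sigma e *
  `|rho e + t * (rho' e - rho e)| `^ (p - 1) * (rho' e - rho e).
have F_ge0 t : 0 < t < 1 -> 0 <= F t.
  move=> t01; pose rt : edge_space R G := rho + t *: (rho' - rho).
  have Art : Adm Gamma rt by apply: Adm_segment => //; lra.
  have [rr|neq] := eqVneq rho' rho.
    by rewrite /F big1// => e _; rewrite rr subrr mulr0.
  have coord e : rt e = rho e + t * (rho' e - rho e) by rewrite !ffunE.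
  have neqt : rho != rt.
    apply: contra neq => /eqP/ffunP eqt; apply/eqP/ffunP => e.
    have /eqP : t * (rho' e - rho e) = 0 by have := coord e; rewrite -eqt; lra.
    rewrite mulf_eq0 subr_eq0 => /orP[/eqP t0|/eqP//]; lra.
  have := energy_gt_tangent p1 s0 Art.1 Ar.1 neqt.
  have -> : \sum_e sigma e * rt e `^ (p - 1) * (rho e - rt e) = - t * F t.
    rewrite /F mulr_sumr; apply: eq_bigr => e _.
    rewrite coord ger0_norm; last by rewrite -coord; exact: Art.1.
    ring.
  move=> lt_rt; have le_rt := rmin _ Art.
  have ptF : 0 < p * t * F t by lra.
  by rewrite -(pmulr_rge0 _ (_ : 0 < p * t)) ?ltW// mulr_gt0//; lra.
have -> : \sum_e sigma e * rho e `^ (p - 1) * (rho' e - rho e) = F 0.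
  apply: eq_bigr => e _; rewrite mul0r addr0 ger0_norm//; exact: Ar.1.
have F_cont : continuous F.
  apply: (continuous_big (op := +%R)); first exact: add_continuous.
  move=> e _ t; apply: cvgMr_tmp; apply: cvgMl_tmp.
  apply: (@continuous_comp _ _ _ (fun t : R => rho e + t * (rho' e - rho e))
    (fun x : R => `|x| `^ (p - 1))); last exact: continuous_norm_powR.
  by apply: cvgD; [exact: cvg_cst|apply: cvgMr_tmp; exact: cvg_id].
have F_cvg : F t @[t --> 0^'+] --> F 0.
  by apply: cvg_at_right_filter; exact: F_cont.
rewrite -(cvg_lim _ F_cvg)//; apply: limr_ge.
  by apply/cvg_ex; exists (F 0).
near=> t; apply: F_ge0; apply/andP; split; near: t.
- exact: nbhs_right_gt.
- exact: nbhs_right_lt.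
Unshelve. all: by end_near. Qed.

Lemma minimizer_Mod p sigma Gamma rho : Adm Gamma rho ->
  (forall rho', Adm Gamma rho' -> energy p sigma rho <= energy p sigma rho') ->
  Mod p sigma Gamma = energy p sigma rho.
Proof.
move=> Ar rmin; apply/eqP; rewrite eq_le; apply/andP; split.
  apply: ge_inf; last by exists rho.
  by exists (energy p sigma rho) => _ [rho' Ar' <-]; exact: rmin.
apply: lb_le_inf; first by exists (energy p sigma rho), rho.
by move=> _ [rho' Ar' <-]; exact: rmin.
Qed.

(** Strictness of the tangent inequality turns the first-order condition into
    optimality and uniqueness at once. *)
Lemma unique_optimal p sigma Gamma rho : 1 < p -> (forall e, 0 < sigma e) ->
  Adm Gamma rho ->
  (forall rho', Adm Gamma rho' ->
    0 <= \sum_e sigma e * rho e `^ (p - 1) * (rho' e - rho e)) ->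
  unique (optimal p sigma Gamma) rho.
Proof.
move=> p1 s0 Ar var.
have rlt rho' : Adm Gamma rho' -> rho' != rho ->
    energy p sigma rho < energy p sigma rho'.
  move=> Ar' neq; apply: energy_lt => //; last exact: var.
    exact: Ar.1.
  exact: Ar'.1.
have Mr : Mod p sigma Gamma = energy p sigma rho.
  apply: minimizer_Mod => // rho' Ar'.
  by have [->//|neq] := eqVneq rho' rho; exact/ltW/rlt.
split=> [|rho' [Ar']]; first by split.
rewrite Mr; have [->//|neq eqE] := eqVneq rho' rho.
by have := rlt _ Ar' neq; rewrite eqE ltxx.
Qed.

End Variational.

(** * Existence of optimal densities *)

Lemma continuous_coord_sum (R : realType) (I : finType) (h : I -> R -> R) :
  (forall i, continuous (h i)) ->
  continuous (fun f : {ptws I -> R} => \sum_i h i (f i)).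
Proof.
move=> h_cont; apply: (continuous_big (op := +%R)) => [|i _ f].
  exact: add_continuous.
apply: (@continuous_comp _ _ _ (fun f : {ptws I -> R} => f i) (h i)).
  exact: (@proj_continuous _ (fun=> R) i).
exact: h_cont.
Qed.

Lemma Adm_nonempty (R : realType) (G : graph) (Gamma : object_family R G) :
  nontrivial Gamma -> Adm Gamma !=set0.
Proof.
move=> [_ nt]; pose len (gamma : Gamma) : R := \sum_e usage gamma e.
have len_gt0 gamma : 0 < len gamma.
  have [e ge0] := nt gamma; rewrite /len (bigD1 e)//= ltr_pwDl//.
  by apply: sumr_ge0 => e' _; exact: usage_ge0.
(* A constant above the inverse total usage of every object is admissible. *)
pose C : R := \sum_gamma (len gamma)^-1.
have C_ge gamma : (len gamma)^-1 <= C.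
  rewrite /C (bigD1 gamma)//= lerDl sumr_ge0// => g _.
  by rewrite invr_ge0 ltW.
exists [ffun=> C]; split=> [e|gamma].
  by rewrite ffunE sumr_ge0// => g _; rewrite invr_ge0 ltW.
under eq_bigr do rewrite ffunE.
rewrite -mulr_suml; have := C_ge gamma.
by rewrite -[X in X <= _]mulr1 ler_pdivrMl ?len_gt0.
Qed.

(** Only densities of energy at most that of some admissible [rho0] compete;
    these lie in a box, which is compact in the product topology. *)
Lemma exists_minimizer (R : realType) (G : graph) (p : R)
    (sigma : edge_space R G) (Gamma : object_family R G) :
  0 < p -> (forall e, 0 < sigma e) -> nontrivial Gamma ->
  exists2 rho, Adm Gamma rho &
    forall rho', Adm Gamma rho' -> energy p sigma rho <= energy p sigma rho'.
Proof.
move=> p0 s0 /Adm_nonempty[rho0 A0]; set L := energy p sigma rho0.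
pose bound e : R := (L / sigma e) `^ p^-1.
pose T := {ptws edge G -> R}.
pose cost (gamma : Gamma) (f : T) : R := \sum_e (usage gamma e : R) * f e.
have cost_cont gamma : continuous (cost gamma).
  apply: (@continuous_coord_sum _ _ (fun e x => (usage gamma e : R) * x)).
  move=> e x; exact: cvgMl_tmp cvg_id.
(* Extends the energy continuously to functions with negative values. *)
pose J (f : T) : R := \sum_e (sigma e : R) * `|f e| `^ p.
have J_cont : continuous J.
  apply: (@continuous_coord_sum _ _ (fun e x => (sigma e : R) * `|x| `^ p)).
  by move=> e x; apply: cvgMl_tmp; exact: continuous_norm_powR.
pose box : set T := [set f | forall e, `[0, bound e]%classic (f e)].
pose K : set T := box `&` \bigcap_gamma cost gamma @^-1` [set x | 1 <= x].
have box_compact : compact box.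
  exact: (@tychonoff (edge G) (fun=> R) (fun e => `[0, bound e]%classic)
    (fun e => @segment_compact R 0 (bound e))).
have K_compact : compact K.
  apply: (compact_closedI box_compact).
  apply: closed_bigI => gamma _.
  apply: (@closed_comp _ _ (cost gamma)) => [f _|]; first exact: cost_cont.
  exact: closed_ge.
have J_energy (rho : edge_space R G) :
    (forall e, 0 <= rho e) -> J rho = energy p sigma rho.
  by move=> r0; apply: eq_bigr => e _; rewrite ger0_norm.
have K_Adm (rho : edge_space R G) :
    Adm Gamma rho -> energy p sigma rho <= L -> K rho.
  move=> [r0 r1] rL; split=> [e|gamma _]; last exact: r1.
  rewrite /= in_itv/= r0/=.
  have -> : rho e = (rho e `^ p) `^ p^-1.
    by rewrite -powRrM divff ?gt_eqF// powRr1.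
  rewrite ge0_ler_powR ?nnegrE ?powR_ge0//.
  - by rewrite invr_ge0 ltW.
  - rewrite divr_ge0//; last exact: ltW.
    by apply: sumr_ge0 => e' _; rewrite mulr_ge0 ?powR_ge0// ltW.
  rewrite ler_pdivlMr// mulrC (le_trans _ rL)// /energy (bigD1 e)//= lerDl.
  by apply: sumr_ge0 => e' _; rewrite mulr_ge0 ?powR_ge0// ltW.
have K0 : K rho0 by exact: K_Adm.
have [|f fK fmin] := compact_EVT_min (f := J) (ex_intro _ _ K0) K_compact.
  exact: continuous_subspaceT.
move: fK; rewrite inE => -[fbox fcost].
have f0 e : 0 <= f e by have := fbox e; rewrite /= in_itv => /andP[].
pose rho : edge_space R G := [ffun e => f e].
have Jrho : energy p sigma rho = J f.
  by apply: eq_bigr => e _; rewrite ffunE ger0_norm.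
exists rho.
  split=> [e|gamma]; first by rewrite ffunE.
  under eq_bigr do rewrite ffunE; exact: fcost.
move=> rho' Ar'; rewrite Jrho.
have [rL|/ltW Lr] := leP (energy p sigma rho') L.
  by rewrite -(J_energy _ Ar'.1) fmin// inE; exact: K_Adm.
by apply: le_trans Lr; rewrite /L -(J_energy _ A0.1) fmin// inE.
Qed.

(** * Extreme points and the blocker *)

Section ExtremePoints.
Variables (R : realType) (G : graph) (Gamma : object_family R G).
Local Notation E := (edge G).
Implicit Types (rho d eta : edge_space R G) (i : Gamma + E).

Let lhs i d : R :=
  match i with inl gamma => \sum_e usage gamma e * d e | inr e => d e end.

Let rhs i : R := if i is inl _ then 1 else 0.

Let AdmE rho : Adm Gamma rho <-> forall i, rhs i <= lhs i rho.
Proof.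
split=> [[r0 r1] [gamma|e]|H]; [exact: r1|exact: r0|].
by split=> [e|gamma]; [exact: (H (inr e))|exact: (H (inl gamma))].
Qed.

Let lhsD i rho d (s : R) :
  lhs i (rho + s *: d) = lhs i rho + s * lhs i d.
Proof.
case: i => [gamma|e] /=; last by rewrite !ffunE.
rewrite mulr_sumr -big_split; apply: eq_bigr => e _ /=.
rewrite !ffunE /GRing.scale /=; ring.
Qed.

Let loose rho : {set Gamma + E} := [set i | lhs i rho != rhs i]%SET.

(* Along a direction that keeps the tight constraints tight and decreases the
   value of some constraint, go as far as the polyhedron allows: the first
   constraint to be reached becomes tight. *)
Let step rho d i0 : Adm Gamma rho ->
  (forall i, i \notin loose rho -> lhs i d = 0) -> lhs i0 d < 0 ->
  exists s : R, [/\ 0 <= s, Adm Gamma (rho + s *: d) &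
    (#|loose (rho + s *: d)%R| < #|loose rho|)%N].
Proof.
move=> /AdmE Ar dflat di0.
pose ratio i : R := (lhs i rho - rhs i) / - lhs i d.
pose P := [pred i | lhs i d < 0].
have [i1 Pi1 i1min] := @arg_minP _ _ _ i0 P ratio di0.
have {}Pi1 : lhs i1 d < 0 by [].
exists (ratio i1); split.
- by rewrite divr_ge0 ?subr_ge0// oppr_ge0 ltW.
- apply/AdmE => i; rewrite lhsD.
  have s0 : 0 <= ratio i1 by rewrite divr_ge0 ?subr_ge0// oppr_ge0 ltW.
  have [di|di] := leP 0 (lhs i d).
    by rewrite (le_trans (Ar i))// lerDl mulr_ge0.
  have : ratio i1 <= ratio i by exact: i1min.
  rewrite {2}/ratio ler_pdivlMr ?oppr_gt0//; lra.
have i1_tight : lhs i1 (rho + ratio i1 *: d) = rhs i1.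
  rewrite lhsD /ratio; field; exact: ltr0_neq0.
apply/proper_card/properP; split.
  apply/fintype.subsetP => i; apply: contraTT => tight; have := tight.
  by rewrite !inE !negbK lhsD (dflat _ tight) mulr0 addr0.
exists i1; last by rewrite inE i1_tight eqxx.
by apply: contraLR Pi1 => /dflat ->; rewrite ltxx.
Qed.

(** If [rho] is not extreme, it lies inside a segment from y to z, along which
    the constraints tight at [rho] are constant. One of the directions y - z
    and z - y does not increase the pairing with [eta] and decreases some
    coordinate, because [eta] is nonnegative. The ray in that direction leaves
    Adm(Gamma), and at the exit point one more constraint is tight: induct on
    the number of constraints that are not. *)
Lemma extreme_point_below eta rho : (forall e, 0 <= eta e) -> Adm Gamma rho ->
  exists2 x, extreme_points (Adm Gamma) x &
    \sum_e x e * eta e <= \sum_e rho e * eta e.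
Proof.
move=> eta0; have [n] := ubnP #|loose rho|; elim: n rho => // n IH rho.
rewrite ltnS => le_n Ar.
have [ext|next] := pselect (extreme_points (Adm Gamma) rho).
  by exists rho.
pose descends d := [/\ forall i, i \notin loose rho -> lhs i d = 0,
  exists i, lhs i d < 0 & \sum_e d e * eta e <= 0].
suff [d [dflat [i di] deta]] : exists d, descends d.
  have [s [s0 As lts]] := step Ar dflat di.
  have [x extx xle] := IH _ (leq_trans lts le_n) As; exists x => //.
  apply: le_trans xle _; rewrite -subr_ge0 -sumrB.
  have -> : \sum_e (rho e * eta e - (rho + s *: d) e * eta e) =
      - (s * \sum_e d e * eta e).
    rewrite mulr_sumr -sumrN; apply: eq_bigr => e _.
    rewrite !ffunE /GRing.scale /=; ring.
  by rewrite oppr_ge0 mulr_ge0_le0.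
have [y [z [t [Ay Az t01 rhoE yz]]]] : exists y z (t : R),
    [/\ Adm Gamma y, Adm Gamma z, 0 < t < 1, rho = t *: y + (1 - t) *: z
      & y != z].
  apply: contrapT => none; apply: next; split=> // y z t Ay Az t01 rhoE.
  suff yz : y = z by rewrite rhoE -yz -scalerDl addrC subrK scale1r.
  by apply: contrapT => /eqP yz; apply: none; exists y, z, t.
have tt : 0 < t by lra.
have t1 : 0 < 1 - t by lra.
have lhs_rho i : lhs i rho = t * lhs i y + (1 - t) * lhs i z.
  rewrite rhoE lhsD; congr (_ + _).
  by have := lhsD i 0 y t; rewrite add0r => ->; case: i => [g|e] /=;
    rewrite ?ffunE ?add0r// big1 ?add0r// => e _; rewrite ffunE mulr0.
have lhsB i (u v : edge_space R G) : lhs i (u - v) = lhs i u - lhs i v.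
  by rewrite -[- v]scaleN1r lhsD mulN1r.
have flat i : i \notin loose rho -> lhs i y = lhs i z.
  rewrite inE negbK lhs_rho => /eqP tight.
  have /AdmE/(_ i) yi := Ay; have /AdmE/(_ i) zi := Az.
  have ty := mulr_ge0 (ltW tt) (_ : 0 <= lhs i y - rhs i).
  have tz := mulr_ge0 (ltW t1) (_ : 0 <= lhs i z - rhs i).
  have := ty; have := tz; rewrite !subr_ge0 => /(_ zi) {}tz /(_ yi) {}ty.
  have /eqP : t * (lhs i y - rhs i) = 0 by lra.
  have /eqP : (1 - t) * (lhs i z - rhs i) = 0 by lra.
  by rewrite !mulf_eq0 (gt_eqF tt) (gt_eqF t1)/= !subr_eq0 => /eqP-> /eqP->.
pose S d : R := \sum_e d e * eta e.
have descend (u v : edge_space R G) :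
    (forall i, i \notin loose rho -> lhs i u = lhs i v) ->
    S (u - v) <= 0 -> (exists e, (u - v) e < 0) -> exists d, descends d.
  move=> uv Suv [e uve]; exists (u - v); split=> //; last by exists (inr e).
  by move=> i il; rewrite lhsB uv// subrr.
have neg d : S d < 0 -> exists e, d e < 0.
  move=> Sd; apply: contrapT => none; move: Sd; rewrite ltNge => /negP; apply.
  apply: sumr_ge0 => e _; rewrite mulr_ge0// leNgt; apply/negP => de.
  by apply: none; exists e.
have flat' i : i \notin loose rho -> lhs i z = lhs i y by move/flat.
have SN : S (z - y) = - S (y - z).
  by rewrite /S -sumrN; apply: eq_bigr => e _; rewrite !ffunE; ring.
(* When [S] is constant on the segment both directions are allowed, and one of
   them has a negative coordinate. *)
have [Slt|Sgt|S0] := ltgtP (S (y - z)) 0.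
- by apply: (descend y z) => //; [exact: ltW|exact: neg].
- have Szy : S (z - y) < 0 by rewrite SN oppr_lt0.
  by apply: (descend z y) => //; [exact: ltW|exact: neg].
have [e ne] : exists e, y e != z e.
  apply/existsP; apply: contraNT yz; rewrite negb_exists => /forallP yz.
  by apply/eqP/ffunP => e; apply/eqP; rewrite -[_ == _]negbK.
case: (ltgtP (y e) (z e)) ne => // lt_e _.
- by apply: (descend y z) => //; [rewrite S0|exists e; rewrite !ffunE subr_lt0].
- by apply: (descend z y) => //;
    [rewrite SN S0 oppr0|exists e; rewrite !ffunE subr_lt0].
Qed.

End ExtremePoints.

(** The blocker as a polar set: every admissible density of Gamma, not only
    the extreme points, bounds the admissible densities of the blocker. *)
Lemma Adm_blockerP (R : realType) (G : graph) (Gamma : object_family R G)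
    (eta : edge_space R G) :
  Adm (blocker Gamma) eta <->
  (forall e, 0 <= eta e) /\
  (forall rho, Adm Gamma rho -> 1 <= \sum_e rho e * eta e).
Proof.
split=> -[eta0 eta1]; split=> //.
- move=> rho Ar; have [x extx xle] := extreme_point_below eta0 Ar.
  apply: le_trans xle.
  have xin : x \in fset_set (extreme_points (Adm Gamma)).
    by rewrite in_fset_set ?inE//; exact: extreme_points_finite.
  exact: (eta1 (FSetSub xin : blocker Gamma)).
- move=> x; apply: eta1; have := valP (x : blocker_object Gamma).
  rewrite in_fset_set ?inE; last exact: extreme_points_finite.
  by case.
Qed.

(** * Duality *)

Unset Implicit Arguments.

Theorem theorem3p7 (R : realType) (G : graph) (Gamma : object_family R G)
    (hGamma : nontrivial Gamma) (p q : R) (hp : 1 < p) (hq : q = p / (p - 1))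
    (sigma : edge_space R G) (hsigma : forall e, 0 < sigma e) :
  Mod p sigma Gamma `^ p^-1 *
    Mod q (dual_weights p q sigma) (blocker Gamma) `^ q^-1 = 1 /\
  exists rho eta : edge_space R G,
    [/\ unique (optimal p sigma Gamma) rho,
        unique (optimal q (dual_weights p q sigma) (blocker Gamma)) eta &
        forall e, eta e = sigma e * rho e `^ (p - 1) / Mod p sigma Gamma].
Proof.
have p0 : 0 < p by lra.
have pB1 : 0 < p - 1 by lra.
have [rho Ar rmin] := exists_minimizer p0 hsigma hGamma.
have ME := minimizer_Mod Ar rmin.
have var := minimizer_variational hp hsigma Ar rmin.
set M := Mod p sigma Gamma in ME *.
have [r0 r1] := Ar.
have sumM : \sum_e sigma e * rho e `^ (p - 1) * rho e = M.
  rewrite ME; apply: eq_bigr => e _.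
  by rewrite -(mulr_powRB1 (r0 e) p0); ring.
have M0 : 0 < M.
  rewrite lt_neqAle ME sumr_ge0 ?andbT; last first.
    by move=> e _; rewrite mulr_ge0 ?powR_ge0// ltW.
  apply/eqP => /esym /eqP; rewrite psumr_eq0; last first.
    by move=> e _; rewrite mulr_ge0 ?powR_ge0// ltW.
  move=> /allP E0; have [/card_gt0P[gamma _] _] := hGamma.
  have := r1 gamma; rewrite big1 ?ler10// => e _.
  have := E0 e; rewrite mem_index_enum mulf_eq0 gt_eqF//= => /(_ isT).
  by rewrite powR_eq0 => /andP[/eqP-> _]; rewrite mulr0.
have q1 : 1 < q by rewrite hq ltr_pdivlMr// mul1r; lra.
have qB1 : q - 1 = (p - 1)^-1 by rewrite hq; field; rewrite gt_eqF.
have qp : q / p = q - 1.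
  by rewrite qB1 hq; field; rewrite !gt_eqF.
pose sigma' := dual_weights p q sigma.
have sigma'0 e : 0 < sigma' e by rewrite ffunE powR_gt0.
pose eta : edge_space R G := [ffun e => sigma e * rho e `^ (p - 1) / M].
have etaE e : eta e = sigma e * rho e `^ (p - 1) / M by rewrite ffunE.
have eta0 e : 0 <= eta e.
  by rewrite etaE !mulr_ge0 ?powR_ge0 ?invr_ge0// ltW.
have pair_rho : \sum_e rho e * eta e = 1.
  rewrite -[RHS](divff (lt0r_neq0 M0)) -[in X in X / _]sumM mulr_suml.
  by apply: eq_bigr => e _; rewrite etaE; ring.
have Aeta : Adm (blocker Gamma) eta.
  apply/Adm_blockerP; split=> // rho' Ar'.
  rewrite -pair_rho -subr_ge0 -sumrB.
  have -> : \sum_e (rho' e * eta e - rho e * eta e) =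
      (\sum_e sigma e * rho e `^ (p - 1) * (rho' e - rho e)) / M.
    by rewrite mulr_suml; apply: eq_bigr => e _; rewrite etaE; ring.
  by rewrite divr_ge0 ?var// ltW.
(* The weights and the exponent of the dual problem are the ones for which its
   gradient at [eta] is a multiple of [rho]. *)
have grad_eta e : sigma' e * eta e `^ (q - 1) = M `^ (1 - q) * rho e.
  have s0 := ltW (hsigma e); have rp0 := powR_ge0 (rho e) (p - 1).
  have pq : (rho e `^ (p - 1)) `^ (q - 1) = rho e.
    by rewrite -powRrM qB1 divff ?gt_eqF// powRr1.
  have Mq : M^-1 `^ (q - 1) = M `^ (1 - q).
    by rewrite -(powR_inv1 (ltW M0)) -powRrM mulN1r opprB.
  rewrite ffunE etaE qp (powRM _ (mulr_ge0 s0 rp0)) ?invr_ge0 ?ltW//.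
  rewrite (powRM _ s0 rp0) pq Mq powRN.
  by field; rewrite gt_eqF// powR_gt0.
have uniq_eta : unique (optimal q sigma' (blocker Gamma)) eta.
  apply: unique_optimal => // eta' /Adm_blockerP[_ /(_ _ Ar) eta'1].
  have -> : \sum_e sigma' e * eta e `^ (q - 1) * (eta' e - eta e) =
      M `^ (1 - q) * (\sum_e rho e * eta' e - \sum_e rho e * eta e).
    rewrite -sumrB mulr_sumr; apply: eq_bigr => e _.
    by rewrite grad_eta; ring.
  by rewrite mulr_ge0 ?powR_ge0// pair_rho subr_ge0.
have Mq : Mod q sigma' (blocker Gamma) = M `^ (1 - q).
  have [[_ <-] _] := uniq_eta.
  rewrite -[RHS]mulr1 -[X in _ * X]pair_rho mulr_sumr.
  apply: eq_bigr => e _; rewrite -(mulr_powRB1 (eta0 e)); last lra.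
  by rewrite mulrCA grad_eta; ring.
split; last first.
  exists rho, eta; split; [|exact: uniq_eta|exact: etaE].
  exact: unique_optimal hp hsigma Ar var.
rewrite Mq -powRrM -powRD; last by rewrite (lt0r_neq0 M0) implybT.
have -> : p^-1 + (1 - q) / q = 0 by rewrite hq; field; rewrite !gt_eqF.
by rewrite powRr0.
Qed.
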